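(* Let $G$ be a topological group and let $K$ be any closed subgroup of $G$. If $S$ is a $K$-space, then the $G$-orbit space $(G\times_K S)/G$ is homeomorphic to a retract of the $K$-orbit space $(G\times_K S)/K$.
   Context: The topological group $G$ and the space $S$ are assumed Tychonoff (completely regular and Hausdorff). A $K$-space is a space with a continuous action of $K$. The twisted product $G\times_K S$ is the orbit space (with the quotient topology) of the $K$-action on $G\times S$ given by $k(g,s)=(gk^{-1},ks)$; $[g,s]$ denotes the $K$-orbit of $(g,s)$. The group $G$ acts on $G\times_K S$ by $g'[g,s]=[g'g,s]$, and $K\subset G$ acts by restriction of this action. Orbit spaces carry the quotient topology. A retract of a space $Y$ is a subspace $R\subset Y$ for which there is a continuous map $r:Y\to R$ with $r|_R=\mathrm{id}_R$. *)

(* Defs.v *)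
From HB Require Import structures.
From mathcomp Require Import all_boot all_order all_algebra.
From mathcomp Require Import all_classical all_reals all_analysis.

Set Implicit Arguments.
Unset Strict Implicit.
Unset Printing Implicit Defensive.

Local Open Scope classical_set_scope.
Local Open Scope quotient_scope.
Local Open Scope group_scope.

HB.mixin Record isTopologicalGroup G of Topological G & Group G := {
  mulg_continuous : continuous (fun x : G * G => x.1 * x.2);
  invg_continuous : continuous (fun x : G => x^-1)
}.

#[short(type="topologicalGroupType")]
HB.structure Definition TopologicalGroup :=
  {G of Topological G & Group G & isTopologicalGroup G}.

Definition tychonoff_space (T : topologicalType) : Prop :=
  completely_regular_space T /\ hausdorff_space T.

(* The subgroup K as a group in its own right; the topology on [set_type] is
   the subspace topology. *)
Definition subgroup (G : groupType) (K : groupClosed G) : Type :=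
  set_type [set` K].

Section Subgroup.
Context (G : topologicalGroupType) (K : groupClosed G).
Local Notation H := (subgroup K).

Lemma subgroup_closed : group_closed (mem [set` K]).
Proof.
split=> [|x y]; first by rewrite inE; exact: gpred1.
by rewrite !inE => /= xK yK; exact: gpredF.
Qed.

HB.instance Definition _ := [isSub of H for (@set_val G [set` K])].
HB.instance Definition _ := Topological.copy H (set_type [set` K]).
HB.instance Definition _ :=
  SubChoice_isSubGroup.Build G (mem [set` K]) H subgroup_closed.

Let val_continuous : continuous (val : H -> G).
Proof. exact: (@initial_continuous (set_type [set` K]) G set_val). Qed.

Let continuous_into (T : topologicalType) (f : T -> H) :
  continuous (val \o f) -> continuous f.
Proof.
move=> /continuousP cf; apply/continuousP => _ [B oB <-].
by rewrite -comp_preimage; exact: cf.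
Qed.

Lemma subgroup_mul_continuous : continuous (fun x : H * H => x.1 * x.2).
Proof.
apply: continuous_into => -[x y].
rewrite (_ : val \o _ = fun z : H * H => (val z.1 : G) * val z.2); last first.
  by apply/funext => z /=; rewrite valM.
apply: (@continuous_comp _ _ _ (fun z : H * H => (val z.1 : G, val z.2 : G))
  (fun z : G * G => z.1 * z.2)); last exact: mulg_continuous.
apply: cvg_pair => /=.
  by apply: (@cvg_comp _ _ _ fst (val : H -> G)); [exact: cvg_fst|
    exact: val_continuous].
by apply: (@cvg_comp _ _ _ snd (val : H -> G)); [exact: cvg_snd|
  exact: val_continuous].
Qed.

Lemma subgroup_inv_continuous : continuous (fun x : H => x^-1).
Proof.
apply: continuous_into => x.
rewrite (_ : val \o _ = fun z : H => (val z : G)^-1); last first.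
  by apply/funext => z.
apply: (@continuous_comp _ _ _ (val : H -> G) (fun z => z^-1)).
  exact: val_continuous.
exact: invg_continuous.
Qed.

HB.instance Definition _ :=
  isTopologicalGroup.Build H subgroup_mul_continuous subgroup_inv_continuous.
End Subgroup.

Record left_action (H : groupType) (T : Type) := LeftAction {
  act :> H -> T -> T;
  act1 : forall x, act 1 x = x;
  actM : forall g h x, act (g * h) x = act g (act h x)
}.

Definition continuous_action (H : topologicalGroupType) (S : topologicalType)
    (a : left_action H S) : Prop :=
  continuous (fun p : H * S => a p.1 p.2).

Section OrbitSpace.
Context (H : groupType) (T : topologicalType) (a : left_action H T).

Definition orbit_rel : rel T := fun x y => `[< exists g, y = a g x >].

Lemma orbit_rel_refl : reflexive orbit_rel.
Proof. by move=> x; apply/asboolP; exists 1; rewrite act1. Qed.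

Lemma orbit_rel_sym : symmetric orbit_rel.
Proof.
suff s x y : orbit_rel x y -> orbit_rel y x by move=> x y; apply/idP/idP => /s.
move=> /asboolP[g ->]; apply/asboolP; exists g^-1.
by rewrite -actM mulVg act1.
Qed.

Lemma orbit_rel_trans : transitive orbit_rel.
Proof.
move=> y x z /asboolP[g ->] /asboolP[h ->]; apply/asboolP; exists (h * g).
by rewrite actM.
Qed.

Canonical orbit_equiv_rel :=
  EquivRel orbit_rel orbit_rel_refl orbit_rel_sym orbit_rel_trans.

Definition orbit_space : topologicalType :=
  quotient_topology {eq_quot orbit_equiv_rel}.

Definition orbit_of (x : T) : orbit_space := \pi_{eq_quot orbit_equiv_rel} x.

Lemma orbit_ofP x y : orbit_of x = orbit_of y <-> exists g, y = a g x.
Proof. by split=> [/eqmodP/asboolP|/asboolP xy]; last exact/eqmodP. Qed.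

Lemma orbit_of_repr (u : orbit_space) :
  orbit_of (repr (u : {eq_quot orbit_equiv_rel})) = u.
Proof. exact: reprK. Qed.
End OrbitSpace.

Section TwistedProduct.
Context (G : topologicalGroupType) (K : groupClosed G) (S : topologicalType).
Variable a : left_action (subgroup K) S.

Definition twist (k : subgroup K) (p : G * S) : G * S :=
  (p.1 * (val k)^-1, a k p.2).

Lemma twist1 p : twist 1 p = p.
Proof. by case: p => g s; rewrite /twist val1 invg1 mulg1 act1. Qed.

Lemma twistM k l p : twist (k * l) p = twist k (twist l p).
Proof. by rewrite /twist /= valM invgM mulgA actM. Qed.

Definition twisted_action := LeftAction twist1 twistM.

Definition twisted_product : topologicalType := orbit_space twisted_action.

Definition twisted_class (g : G) (s : S) : twisted_product :=
  orbit_of twisted_action (g, s).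

(* Defined on a chosen representative; [translateE] shows that the choice does
   not matter, i.e. g [h, s] = [g h, s]. *)
Definition translate (g : G) (u : twisted_product) : twisted_product :=
  let p : G * S := repr (u : {eq_quot orbit_equiv_rel twisted_action}) in
  twisted_class (g * p.1) p.2.

Lemma translateE g h s :
  translate g (twisted_class h s) = twisted_class (g * h) s.
Proof.
rewrite /translate; set p : G * S := repr _.
have /orbit_ofP[k [-> ->]] : orbit_of twisted_action p = twisted_class h s.
  exact: orbit_of_repr.
by apply/orbit_ofP; exists k; rewrite /= /twist /= mulgA.
Qed.

Lemma twisted_classP (u : twisted_product) : exists g s, u = twisted_class g s.
Proof.
exists (repr (u : {eq_quot orbit_equiv_rel twisted_action})).1.
exists (repr (u : {eq_quot orbit_equiv_rel twisted_action})).2.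
by rewrite /twisted_class -surjective_pairing orbit_of_repr.
Qed.

Lemma translate1 u : translate 1 u = u.
Proof. by have [g [s ->]] := twisted_classP u; rewrite translateE mul1g. Qed.

Lemma translateM g h u : translate (g * h) u = translate g (translate h u).
Proof. by have [x [s ->]] := twisted_classP u; rewrite !translateE mulgA. Qed.

Definition translation_action : left_action G twisted_product :=
  LeftAction translate1 translateM.
End TwistedProduct.

Section Restriction.
Context (G : topologicalGroupType) (K : groupClosed G) (T : Type).
Variable a : left_action G T.

Lemma restrict1 x : a (val (1 : subgroup K)) x = x.
Proof. by rewrite val1 act1. Qed.

Lemma restrictM (g h : subgroup K) x :
  a (val (g * h)) x = a (val g) (a (val h) x).
Proof. by rewrite valM actM. Qed.

Definition restrict_action : left_action (subgroup K) T :=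
  @LeftAction (subgroup K) T (fun k => a (val k)) restrict1 restrictM.
End Restriction.
Arguments restrict_action {G} K {T} a.

Definition homeomorphic (X Y : topologicalType) : Prop :=
  exists (f : X -> Y) (g : Y -> X),
    [/\ continuous f, continuous g, cancel f g & cancel g f].

Definition is_retract (Y : topologicalType) (R : set Y) : Prop :=
  exists r : Y -> R, continuous r /\ forall x : R, r (val x) = x.

(* Main.v *)
(** For X = G x_K S, the projection X/K -> X/G has a continuous section: the
    map (g, s) |-> K[1, s] is constant on the fibres of G x S -> X/G, because
    [1, k s] = k [1, s], and hence descends to X/G.  Its image is the retract. *)

Require Import Defs.
From HB Require Import structures.
From mathcomp Require Import all_boot all_order all_algebra.
From mathcomp Require Import all_classical all_reals all_analysis.

Local Open Scope classical_set_scope.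
Local Open Scope quotient_scope.

(** As [p] undoes [j], the composite [j \o p] fixes the range of [j] pointwise. It is therefore a
    retraction onto that range, on which [p] restricts to an inverse of [j]. *)
Lemma section_retract (X Y : topologicalType) (j : X -> Y) (p : Y -> X) :
  continuous j -> continuous p -> cancel j p ->
  exists R : set Y, is_retract R /\ homeomorphic X (R : Type).
Proof.
move=> cj cp jK.
have jR x : j x \in range j by rewrite inE; exists x.
pose jr x : range j := SigSub (jR x).
have cjr : continuous jr.
  (* Open sets of the range are traces of open sets [B] of [Y], so their preimages under [jr] are
     preimages under [j]. *)
  apply/continuousP => _ [B oB <-]; rewrite -comp_preimage.
  by move/continuousP: cj; exact.
have cval : continuous (val : range j -> Y) by exact: initial_continuous.
have jpK (y : range j) : j (p (val y)) = val y.
  by have := valP y; rewrite inE => -[x _ <-]; rewrite jK.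
exists (range j); split.
  exists (jr \o p); split=> [y|y]; last exact/val_inj/jpK.
  by apply: continuous_comp; [exact: cp|exact: cjr].
exists jr, (p \o val); split=> //.
- by move=> y; apply: continuous_comp; [exact: cval|exact: cp].
- by move=> y; exact/val_inj/jpK.
Qed.

Section OrbitSpaceDescent.
Context {H : groupType} {T : topologicalType} (a : left_action H T).
Context {Y : topologicalType}.

(** Evaluation at a chosen representative makes this total in [f]; it is the map induced on orbits
    once [f] is invariant. *)
Definition orbit_lift (f : T -> Y) (u : orbit_space a) : Y :=
  f (repr (u : {eq_quot orbit_equiv_rel a})).

Context (f : T -> Y) (f_inv : forall g x, f (a g x) = f x).

Lemma orbit_lift_of x : orbit_lift f (orbit_of a x) = f x.
Proof.
rewrite /orbit_lift; set y := repr _.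
have /orbit_ofP[g ->] : orbit_of a y = orbit_of a x by exact: orbit_of_repr.
by rewrite f_inv.
Qed.

Lemma orbit_lift_continuous : continuous f -> continuous (orbit_lift f).
Proof.
move=> cf; apply: repr_comp_continuous => // x y /eqP/orbit_ofP[g ->].
by rewrite f_inv.
Qed.

End OrbitSpaceDescent.

Lemma orbit_of_continuous (H : groupType) (T : topologicalType)
    (a : left_action H T) : continuous (orbit_of a).
Proof. exact: pi_continuous. Qed.

Lemma orbit_of_act {H : groupType} {T : topologicalType} (a : left_action H T)
    g x : orbit_of a (a g x) = orbit_of a x.
Proof. by apply/esym/orbit_ofP; exists g. Qed.

Section TwistedProductOrbits.
Context (G : topologicalGroupType) (K : groupClosed G) (S : topologicalType).
Variable a : left_action (subgroup K) S.
Local Open Scope group_scope.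
Local Notation X := (twisted_product a).
Local Notation aG := (translation_action a).
Local Notation aK := (restrict_action K aG).

Definition unit_orbit (p : G * S) : orbit_space aK :=
  orbit_of aK (twisted_class a 1 p.2).

(** This is where passing to K-orbits matters: [1, k s] and [1, s] may differ in the twisted
    product, but k carries the latter to the former. *)
Lemma unit_orbit_twist k p : unit_orbit (twisted_action a k p) = unit_orbit p.
Proof.
rewrite /unit_orbit -(orbit_of_act aK k (twisted_class a 1 p.2)) /=.
rewrite translateE mulg1; congr (orbit_of aK _).
(* Twisting (k, s) by k gives (k k^-1, k s) = (1, k s). *)
by apply/esym/orbit_ofP; exists k; rewrite /= /twist /= mulgV.
Qed.

Lemma unit_orbit_continuous : continuous unit_orbit.
Proof.
move=> p; apply: continuous_comp; last exact: orbit_of_continuous.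
apply: (@continuous_comp _ _ _ (fun q : G * S => (1 : G, q.2))).
  by apply: cvg_pair => /=; [exact: cvg_cst|exact: cvg_snd].
exact: orbit_of_continuous.
Qed.

(** Translation changes only the group coordinate, which [unit_orbit] discards. *)
Lemma unit_orbit_translate g (x : X) :
  orbit_lift (twisted_action a) unit_orbit (aG g x) =
  orbit_lift (twisted_action a) unit_orbit x.
Proof.
have [h [s ->]] := twisted_classP x; rewrite /= translateE.
by rewrite !orbit_lift_of//; exact: unit_orbit_twist.
Qed.

(** The descent takes two stages: from G x S to the twisted product, then to its G-orbits. *)
Definition orbit_section : orbit_space aG -> orbit_space aK :=
  orbit_lift aG (orbit_lift (twisted_action a) unit_orbit).

Definition orbit_projection : orbit_space aK -> orbit_space aG :=
  orbit_lift aK (orbit_of aG).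

Lemma orbit_section_continuous : continuous orbit_section.
Proof.
apply: orbit_lift_continuous; first exact: unit_orbit_translate.
apply: orbit_lift_continuous; first exact: unit_orbit_twist.
exact: unit_orbit_continuous.
Qed.

Lemma orbit_of_restrict (k : subgroup K) x :
  orbit_of aG (aK k x) = orbit_of aG x.
Proof. exact: (orbit_of_act aG (val k)). Qed.

Lemma orbit_projection_continuous : continuous orbit_projection.
Proof.
apply: orbit_lift_continuous; first exact: orbit_of_restrict.
exact: orbit_of_continuous.
Qed.

Lemma orbit_sectionK : cancel orbit_section orbit_projection.
Proof.
move=> u; rewrite -(orbit_of_repr u); set x : X := repr _.
have [g [s ->]] := twisted_classP x.
rewrite /orbit_section orbit_lift_of; last exact: unit_orbit_translate.
rewrite orbit_lift_of; last exact: unit_orbit_twist.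
rewrite /orbit_projection orbit_lift_of; last exact: orbit_of_restrict.
(* The round trip sends G[g, s] to G[1, s], and g [1, s] = [g, s]. *)
by apply/orbit_ofP; exists g; rewrite /= translateE mulg1.
Qed.

End TwistedProductOrbits.

Theorem proposition1p4 (G : topologicalGroupType) (K : groupClosed G)
    (S : topologicalType) (a : left_action (subgroup K) S)
    (tychG : tychonoff_space G) (tychS : tychonoff_space S)
    (closedK : closed [set` K]) (cont_a : continuous_action a) :
  exists R : set (orbit_space (restrict_action K (translation_action a))),
    is_retract R /\
    homeomorphic (orbit_space (translation_action a)) (R : Type).
Proof.
apply: section_retract.
- exact: orbit_section_continuous.
- exact: orbit_projection_continuous.
- exact: orbit_sectionK.
Qed.
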